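(* In the $m$-set semi-bandit problem with $d$ base-arms, consider one round $t$ of FTPL with conditional geometric resampling (CGR). Then the average (expected, conditionally on $\hat L_t$) computational complexity of CGR at the round satisfies $$C_{\mathrm{CGR}}=O\big(md(\log(d/m)+1)\big),$$ with an absolute hidden constant, uniformly in $\hat L_t$ and $\eta_t$.
   Context: Let $1\le m\le d$, $\mathcal{A}=\{a\in\{0,1\}^d:\|a\|_1=m\}$, $\hat L_t\in[0,\infty)^d$, $\eta_t>0$, and let $\mathcal{D}$ be a continuous distribution on $\mathbb{R}$ (the perturbation distribution). FTPL plays $a_t=\arg\min_{a\in\mathcal{A}}a^\top(\eta_t\hat L_t-r_t)$ with $r_t$ having i.i.d. components from $\mathcal{D}$; $w_{t,i}=\mathbb{P}[a_{t,i}=1\mid\hat L_t]>0$. Let $\sigma_i$ be the rank of $\hat L_{t,i}$ among $\hat L_{t,1},\dots,\hat L_{t,d}$ in increasing order (ties broken by a fixed rule). **CGR algorithm** (input $a_t,\hat L_t,\eta_t$; its randomness is independent of $r_t$ given $\hat L_t$): 1. $M:=\mathbf 0\in\mathbb{R}^d$, $s:=a_t$, $C:=\mathbf 1_d$; $U:=\{i:a_{t,i}=1,\sigma_i>m\}$, and $C_i:=\sigma_i/m$ for $i\in U$. 2. Repeat until $s=\mathbf 0$: (a) $M:=M+s$; (b) sample $r'\in\mathbb{R}^d$ i.i.d. from $\mathcal{D}$; (c) $a':=\arg\min_{a\in\mathcal{A}}a^\top(\eta_t\hat L_t-r')$; (d) sample $\theta$ uniformly from $\{1,\dots,m\}$;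 (e) for each $i\in U$: find $i'$ such that $r'_{i'}$ is the $\theta$-th largest in $\{r'_j:\sigma_j\le\sigma_i\}$, let $r''$ be $r'$ with entries $i,i'$ swapped, replace $a'_i$ by the $i$-th entry of $\arg\min_{a\in\mathcal{A}}a^\top(\eta_t\hat L_t-r'')$, and if $a'_i=1$ remove $i$ from $U$; (f) $s:=s\circ(\mathbf 1_d-a')$ (entrywise product). 3. Output $\widehat{w_{t,i}^{-1}}:=C_iM_i$ for $i$ with $a_{t,i}=1$. Cost model: arithmetic operations, comparisons, and drawing one scalar sample each cost $O(1)$; computing a rank $\sigma_i$ of one entry, selecting a $k$-th largest entry, or selecting the $m$ largest entries among at most $d$ numbers costs $O(d)$ (linear-time selection). The expectation is over $a_t$ and the internal randomness of CGR given $\hat L_t$. *)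

(* Defs.v *)
From HB Require Import structures.
From mathcomp Require Import all_boot all_order all_algebra.
From mathcomp Require Import perm finmap.
From mathcomp Require Import all_classical all_reals all_analysis.

Set Implicit Arguments.
Unset Strict Implicit.
Unset Printing Implicit Defensive.

Import Order.TTheory GRing.Theory Num.Theory.
Import numFieldNormedType.Exports.

Local Open Scope ring_scope.

(* Prices of the primitive operations. [op_cost] is one arithmetic operation,
   comparison or memory access, [draw_cost] one scalar sample; the last three are
   prices for inputs of at most n numbers: the rank of one entry, a k-th largest
   entry, and the m largest entries. *)
Record cost_model := CostModel {
  op_cost : nat;
  draw_cost : nat;
  rank_cost : nat -> nat;
  kth_cost : nat -> nat;
  top_cost : nat -> nat }.

Definition cost_model_le (c : nat) (cm : cost_model) : Prop :=
  [/\ (op_cost cm <= c)%N, (draw_cost cm <= c)%N,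
      forall n, (rank_cost cm n <= c * n)%N,
      forall n, (kth_cost cm n <= c * n)%N &
      forall n, (top_cost cm n <= c * n)%N].

(* A computation is its result paired with the accumulated cost. *)
Definition costed (A : Type) : Type := (A * nat)%type.
Definition ret (A : Type) (x : A) : costed A := (x, 0%N).
Definition tick (A : Type) (n : nat) (x : A) : costed A := (x, n).
Definition bind (A B : Type) (e : costed A) (f : A -> costed B) : costed B :=
  ((f e.1).1, (e.2 + (f e.1).2)%N).

Notation "'let*' x ':=' e 'in' f" := (bind e (fun x => f))
  (at level 200, x name, e at level 200, f at level 200,
   format "'[v' 'let*'  x  ':='  e  'in' '/' f ']'").

(* Runs the body on every i in U and stores its result at position i of [v];
   the bodies do not see each other's results, the costs add up. *)
Definition for_each (I : finType) (A : Type) (U : {set I})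
    (body : I -> costed A) (v : {ffun I -> A}) : costed {ffun I -> A} :=
  ([ffun i => if i \in U then (body i).1 else v i],
   (\sum_(i in U) (body i).2)%N).

(* Vectors of {0,1}^d. *)
Definition action (d : nat) := {ffun 'I_d -> bool}.

Definition is_action (d m : nat) (a : action d) : bool :=
  (\sum_(i < d) a i == m)%N.

Section Algorithm.

Context {R : realType}.

(* argmin over m-sets of a^T (eta L - r); ties are broken by the enumeration of
   the finite type of actions. The default value of [arg min] belongs to the
   action set as soon as m <= d. *)
Definition best_action (d m : nat) (eta : R) (L r : 'I_d -> R) : action d :=
  [arg min_(a < [ffun i : 'I_d => (i < m)%N] | is_action m a)
     \sum_(i < d) (a i)%:R * (eta * L i - r i)]%O.

(* [sigma i] is the rank, in 1..d, of [L i] among the entries of L in increasing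
   order; every way of breaking ties is allowed. *)
Definition is_ranking (d : nat) (L : 'I_d -> R) (sigma : 'I_d -> nat) : Prop :=
  [/\ injective sigma,
      forall i, (1 <= sigma i <= d)%N &
      forall i j, L i < L j -> (sigma i < sigma j)%N].

(* The index of the theta-th largest (theta >= 1) entry of r over S; [i0] is
   returned only when theta exceeds the cardinality of S. *)
Definition kth_largest (d : nat) (r : 'I_d -> R) (S : {set 'I_d})
    (theta : nat) (i0 : 'I_d) : 'I_d :=
  nth i0 (sort (fun j k => r k <= r j) (enum S)) theta.-1.

Record state (d : nat) := State {
  visits : {ffun 'I_d -> R};     (* M *)
  pending : action d;           (* s *)
  unresolved : {set 'I_d} }.    (* U *)

Definition halted (d : nat) (st : state d) : bool :=
  pending st == [ffun=> false].

Variables (cm : cost_model) (d m : nat) (eta : R).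
Variables (L : 'I_d -> R) (sigma : 'I_d -> nat).

(* The argmin is computed by selecting the m largest entries of r - eta L. *)
Definition argmin (r : 'I_d -> R) : costed (action d) :=
  tick (2 * d * op_cost cm + top_cost cm d) (best_action m eta L r).

(* Step 1; also returns C. *)
Definition cgr_init (a : action d) : costed (state d * {ffun 'I_d -> R}) :=
  let* M := tick (d * op_cost cm) [ffun=> 0] in
  let* s := tick (d * op_cost cm) a in
  let* ones := tick (d * op_cost cm) [ffun=> 1] in
  let* support := tick (d * op_cost cm) [set i | a i]%SET in
  let* rk := for_each support
    (fun i => tick (rank_cost cm d) (sigma i)) [ffun=> 0%N] in
  let* U := tick (2 * #|support| * op_cost cm)
    [set i in support | (m < rk i)%N]%SET in
  let* C := for_each U
    (fun i => tick (op_cost cm) ((rk i)%:R / m%:R)) ones in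
  ret (State M s U, C).

(* Body of step (e) for one index: the new value of a'_i. The test
   sigma_j <= sigma_i compares L_j with L_i and breaks a possible tie. *)
Definition cgr_swap (r' : 'I_d -> R) (theta : nat) (i : 'I_d) : costed bool :=
  let* S := tick (2 * d * op_cost cm) [set j | (sigma j <= sigma i)%N]%SET in
  let* i' := tick (kth_cost cm d) (kth_largest r' S theta i) in
  let* r'' := tick (3 * op_cost cm) (r' \o tperm i i') in
  let* a'' := argmin r'' in
  tick (op_cost cm) (a'' i).

(* One iteration of step 2 on the fresh samples r' and theta, including the test
   s = 0 that ends it. *)
Definition cgr_step (sample : ('I_d -> R) * nat) (st : state d)
    : costed (state d) :=
  let* M := tick (d * op_cost cm) [ffun i => visits st i + (pending st i)%:R] in
  let* r' := tick (d * draw_cost cm) sample.1 in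
  let* a1 := argmin r' in
  let* theta := tick (draw_cost cm) sample.2 in
  let* U := tick (d * op_cost cm) (unresolved st) in
  let* a2 := for_each U (cgr_swap r' theta) a1 in
  let* U' := tick (2 * #|U| * op_cost cm) [set i in U | ~~ a2 i]%SET in
  let* s := tick (2 * d * op_cost cm) [ffun i => pending st i && ~~ a2 i] in
  tick (d * op_cost cm) (State M s U').

(* At most n iterations of step 2; the k-th one uses [samples k]. Testing before
   the body is harmless since s = a_t is nonzero at the start. *)
Fixpoint cgr_loop (samples : nat -> ('I_d -> R) * nat) (n : nat)
    (st : state d) : costed (state d) :=
  if n is k.+1 then
    let* st' := cgr_loop samples k st in
    if halted st' then ret st' else cgr_step (samples k) st'
  else ret st.

(* CGR on the action a, stopped after at most n iterations. The result is [None]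
   if it has not halted by then, and otherwise the vector of the estimates
   C_i M_i, set to 0 where a_i = 0. *)
Definition cgr (samples : nat -> ('I_d -> R) * nat) (a : action d) (n : nat)
    : costed (option {ffun 'I_d -> R}) :=
  let* init := cgr_init a in
  let* st := cgr_loop samples n init.1 in
  if halted st then
    let* support := tick (d * op_cost cm) [set i | a i]%SET in
    let* out := for_each support
      (fun i => tick (op_cost cm) (init.2 i * visits st i)) [ffun=> 0] in
    ret (Some out)
  else ret None.

(* Cost of the whole run, +oo if the loop does not terminate (and iterations
   are not free): the truncated costs are nondecreasing in n. *)
Definition cgr_cost (samples : nat -> ('I_d -> R) * nat) (a : action d)
    : \bar R :=
  ereal_sup (range (fun n => ((cgr samples a n).2%:R)%:E)).

End Algorithm.

Local Open Scope classical_set_scope.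

Section Probability.

Context {dT : measure_display} {T : measurableType dT} {R : realType}.
Variable P : probability T R.

(* Mutual independence of a family of sets of events. *)
Definition independent_events (I : choiceType) (F : I -> set (set T)) : Prop :=
  forall (J : {fset I}) (E : I -> set T),
    (forall i, i \in J -> F i (E i)) ->
    P (\bigcap_(i in [set` J]) E i) = (\prod_(i <- J) P (E i))%E.

Definition sigma_of {dU : measure_display} {U : measurableType dU}
    (X : T -> U) : set (set T) := preimage_set_system setT X measurable.

Definition has_law (X : {RV P >-> R}) (D : probability R R) : Prop :=
  forall A : set R, measurable A -> distribution P X A = D A.

Definition uniform_on_1_to (m : nat) (X : {RV P >-> nat}) : Prop :=
  forall k : nat,
    P (X @^-1` [set k]) = (if (1 <= k <= m)%N then m%:R^-1 else 0)%:E.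

(* The randomness of a round: the FTPL perturbation r, and for the k-th iteration
   of CGR the fresh perturbation r' k and the index theta k; all the scalars
   involved are mutually independent. *)
Definition cgr_randomness (D : probability R R) (d m : nat)
    (r : 'I_d -> {RV P >-> R}) (r' : nat -> 'I_d -> {RV P >-> R})
    (theta : nat -> {RV P >-> nat}) : Prop :=
  [/\ forall i, has_law (r i) D,
      forall k i, has_law (r' k i) D,
      forall k, uniform_on_1_to m (theta k) &
      independent_events (fun x : 'I_d + nat * option 'I_d =>
        match x with
        | inl i => sigma_of (r i)
        | inr (k, Some i) => sigma_of (r' k i)
        | inr (k, None) => sigma_of (theta k)
        end)].

Definition ftpl_action (d m : nat) (eta : R) (L : 'I_d -> R)
    (r : 'I_d -> {RV P >-> R}) (x : T) : action d :=
  best_action m eta L (fun i => r i x).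

(* w_i *)
Definition ftpl_prob (d m : nat) (eta : R) (L : 'I_d -> R)
    (r : 'I_d -> {RV P >-> R}) (i : 'I_d) : \bar R :=
  P [set x | ftpl_action m eta L r x i].

(* Expected cost of CGR, for fixed L and eta. *)
Definition expected_cgr_cost (cm : cost_model) (d m : nat) (eta : R)
    (L : 'I_d -> R) (sigma : 'I_d -> nat)
    (r : 'I_d -> {RV P >-> R}) (r' : nat -> 'I_d -> {RV P >-> R})
    (theta : nat -> {RV P >-> nat}) : \bar R :=
  (\int[P]_x cgr_cost cm m eta L sigma
     (fun k => ((fun i => r' k i x), theta k x))
     (ftpl_action m eta L r x))%E.

End Probability.

(* The cumulative distribution function is continuous. *)
Definition continuous_distribution (R : realType) (D : probability R R) : Prop :=
  continuous (fun x : R => D `]-oo, x]).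

(* Main.v *)
Require Import Defs.
From HB Require Import structures.
From mathcomp Require Import all_boot all_order all_algebra.
From mathcomp Require Import perm finmap measurable_realfun.
From mathcomp Require Import all_classical all_reals all_analysis.
From mathcomp Require Import zify ring lra.

(** The arms still waiting after [k] iterations bound the cost of the next
    iteration by [O(d)] each, so the cost of a run is [O(d)] times [m] plus the
    number of pairs (iteration, waiting arm). In every iteration a fixed arm [i] is
    hit independently with the same probability [q_i], hence the expected number of
    such pairs is at most [\sum_i w_i / q_i].

    If [sigma_i <= m] then [q_i = w_i]. Otherwise let [S] be the [sigma_i] arms of
    rank at most [sigma_i]. If arm [i] is played then fewer than [m] arms of [S]
    have a larger perturbation than [i], since otherwise exchanging [i] for an
    unplayed one of them would lower the cost. Exchanging the coordinates [i] and
    [j] of an i.i.d. vector preserves its law, and it turns the event "[i] is the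
    [theta]-th largest of [S] and is played" into "[j] is the [theta]-th largest of
    [S], and [i] is played after [i] and [j] are swapped". Summing over [j \in S]
    and [theta <= m] gives [m q_i >= sigma_i w_i]; ties are excluded almost surely
    by the continuity of the distribution.

    Thus [w_i / q_i] is at most [1] for the first [m] ranks and [m / sigma_i] for
    the others, and these sum up to at most [m + m ln (d / m)]. *)

Set Implicit Arguments.
Unset Strict Implicit.
Unset Printing Implicit Defensive.

Import Order.TTheory GRing.Theory Num.Theory.
Import numFieldNormedType.Exports.

Local Open Scope ring_scope.

(** * Deterministic bound on the cost of a run *)

(* Step (e) concerns the waiting arms [i] with [m < sigma i], so whether [i] is hit
   depends on the sample but not on the state. *)
Definition swap_success (R : realType) (d m : nat) (eta : R) (L : 'I_d -> R)
    (sigma : 'I_d -> nat) (sample : ('I_d -> R) * nat) (i : 'I_d) : bool :=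
  let r := sample.1 in
  let S := [set j | (sigma j <= sigma i)%N]%SET in
  if (m < sigma i)%N
  then best_action m eta L (r \o tperm i (kth_largest r S sample.2 i)) i
  else best_action m eta L r i.

(** Closed form of the vector [s] after [k] iterations. It remains meaningful after the loop has
    halted, so that it becomes an intersection of [k.+1] independent events. *)
Definition waiting (R : realType) (d m : nat) (eta : R) (L : 'I_d -> R)
    (sigma : 'I_d -> nat) (samples : nat -> ('I_d -> R) * nat) (a : action d)
    (k : nat) (i : 'I_d) : bool :=
  a i && [forall j : 'I_k, ~~ swap_success m eta L sigma (samples j) i].

Lemma waitingS (R : realType) (d m : nat) (eta : R) (L : 'I_d -> R)
    (sigma : 'I_d -> nat) samples (a : action d) k i :
  waiting m eta L sigma samples a k.+1 i =
  waiting m eta L sigma samples a k i &&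
    ~~ swap_success m eta L sigma (samples k) i.
Proof.
rewrite /waiting -andbA; congr (_ && _); apply/forallP/andP => [h|[/forallP h hk] j].
  split; last exact: (h ord_max).
  by apply/forallP => j; exact: (h (widen_ord (leqnSn k) j)).
have [jk|kj] := ltnP j k; first exact: (h (Ordinal jk)).
by have -> : nat_of_ord j = k by apply/eqP; rewrite eqn_leq kj -ltnS ltn_ord.
Qed.

Section CostBound.
Context {R : realType} (cm : cost_model) (c d m : nat) (eta : R).
Context (L : 'I_d -> R) (sigma : 'I_d -> nat).
Hypotheses (cm_c : cost_model_le c cm) (d_gt0 : (0 < d)%N).

(** The prices add up to at most [c * (6 * d + 4)], and [d] is positive. *)
Lemma cgr_swap_cost r theta i :
  ((cgr_swap cm m eta L sigma r theta i).2 <= c * (10 * d))%N.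
Proof.
have [hop dr rk kt tp] := cm_c; rewrite /cgr_swap /bind /tick /=.
have := kt d; have := tp d; nia.
Qed.

(** In units of [c * d], the operations on whole vectors and the samples amount to 10; each
    unresolved arm adds 10 for its exchange and 2 for the update of [U]. *)
Lemma cgr_step_cost sample st :
  ((cgr_step cm m eta L sigma sample st).2
     <= c * d * (10 + 12 * #|unresolved st|))%N.
Proof.
have [hop dr rk kt tp] := cm_c; rewrite /cgr_step /bind /tick /for_each /=.
have : (\sum_(i in unresolved st) (cgr_swap cm m eta L sigma sample.1 sample.2 i).2
    <= #|unresolved st| * (c * (10 * d)))%N.
  by rewrite -sum_nat_const; apply: leq_sum => i _; exact: cgr_swap_cost.
rewrite /cgr_swap /bind /tick /=; set s := (\sum_(_ in _) _)%N.
move: #|_| => u; have := tp d.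
have : (u * op_cost cm <= u * c * d)%N.
  by rewrite -mulnA leq_mul2l (leq_trans hop) ?orbT// leq_pmulr.
have : (d * op_cost cm <= c * d)%N by rewrite mulnC leq_mul2r hop orbT.
have : (d * draw_cost cm <= c * d)%N by rewrite mulnC leq_mul2r dr orbT.
have : (draw_cost cm <= c * d)%N by rewrite (leq_trans dr)// leq_pmulr.
have -> : (c * d * (10 + 12 * u) = 10 * (c * d) + 12 * (u * c * d))%N by ring.
have -> : (u * (c * (10 * d)) = 10 * (u * c * d))%N by ring.
rewrite -!(mulnA 2); move: (u * c * d)%N (c * d)%N => x y; lia.
Qed.

(** For a pending arm the invariant on [unresolved] makes the choice in [for_each] agree with the
    rank test of [swap_success]. For the other arms the two may differ, but both conjunctions are
    false. *)
Lemma cgr_step_pending sample st i :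
    unresolved st = [set i | pending st i & (m < sigma i)%N]%SET ->
  pending (cgr_step cm m eta L sigma sample st).1 i =
  pending st i && ~~ swap_success m eta L sigma sample i.
Proof.
move=> uE; rewrite /cgr_step /bind /tick /for_each /= !ffunE uE inE.
by case: (pending st i).
Qed.

Lemma cgr_step_unresolved sample st :
    unresolved st = [set i | pending st i & (m < sigma i)%N]%SET ->
  let st' := (cgr_step cm m eta L sigma sample st).1 in
  unresolved st' = [set i | pending st' i & (m < sigma i)%N]%SET.
Proof.
move=> uE st'; apply/setP => i; rewrite [RHS]inE /st' cgr_step_pending//.
rewrite /cgr_step /bind /tick /for_each /= inE !ffunE uE inE.
by rewrite /swap_success; case: (pending st i) (m < sigma i)%N => [] [] //=; rewrite ?andbT ?andbF.
Qed.

Lemma cgr_loop_cost samples (a : action d) st n :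
    pending st = a ->
    unresolved st = [set i | a i & (m < sigma i)%N]%SET ->
  let: (st', k) := cgr_loop cm m eta L sigma samples n st in
  [/\ pending st' =1 waiting m eta L sigma samples a n,
      unresolved st' = [set i | pending st' i & (m < sigma i)%N]%SET &
      (k <= c * (22 * d) *
         \sum_(k < n) \sum_(i < d) waiting m eta L sigma samples a k i)%N].
Proof.
move=> pE uE; elim: n => [|n].
  rewrite /= big_ord0 pE; split => // i.
  by rewrite /waiting; case: (a i) => //=; apply/esym/forallP => -[].
rewrite /= /bind; case: (cgr_loop _ _ _ _ _ _ _) => st' k /= [pE' uE' kle].
have [/eqP h|nh] := boolP (halted st').
  have w0 i : waiting m eta L sigma samples a n i = false.
    by rewrite -pE' h ffunE.
  split => //=.
    by move=> i; rewrite waitingS pE' w0.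
  by rewrite addn0 (leq_trans kle)// leq_mul2l big_ord_recr/= leq_addr orbT.
split.
- by move=> i; rewrite cgr_step_pending// waitingS pE'.
- exact: cgr_step_unresolved.
- rewrite big_ord_recr/= mulnDr leq_add//.
  apply: leq_trans (cgr_step_cost (samples n) st') _.
  have -> : (\sum_(i < d) waiting m eta L sigma samples a n i =
             #|[set i | pending st' i]%SET|)%N.
    rewrite -sum1dep_card [RHS]big_mkcond/=; apply: eq_bigr => i _.
    by rewrite pE'; case: waiting.
  have : (#|unresolved st'| <= #|[set i | pending st' i]%SET|)%N.
    apply: subset_leq_card; apply/fintype.subsetP => i; rewrite uE' !inE.
    by case/andP.
  (* A loop that goes on has a pending arm, so the fixed part of the cost can be charged to the
     arms: [10 + 12 * u <= 22 * p]. *)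
  have : (0 < #|[set i | pending st' i]%SET|)%N.
    apply: contraNT nh; rewrite -eqn0Ngt cards_eq0 => /eqP/setP p0.
    by apply/eqP/ffunP => i; have := p0 i; rewrite !inE ffunE.
  set p := #|[set i | pending st' i]%SET|; set u := #|unresolved st'| => p0 up.
  have -> : (c * (22 * d) * p = c * d * (22 * p))%N by ring.
  by rewrite leq_mul//; lia.
Qed.

(** The action has [m] ones, so initialization and output cost at most [8 + 2] times [c * d * m];
    this is rounded up to 22, the factor of the loop. *)
Lemma cgr_cost_le samples (a : action d) n : (1 <= m)%N -> is_action m a ->
  ((cgr cm m eta L sigma samples a n).2 <= c * (22 * d) *
    (m + \sum_(k < n) \sum_(i < d) waiting m eta L sigma samples a k i))%N.
Proof.
move=> m1 /eqP am.
have cardm : #|[set i | a i]%SET| = m.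
  by rewrite -sum1dep_card big_mkcond/= -am; apply: eq_bigr => i _; case: (a i).
have [hop dr rk kt tp] := cm_c.
rewrite /cgr /bind; set init := cgr_init _ _ _ _.
have pE : pending init.1.1 = a by [].
have uE : unresolved init.1.1 = [set i | a i & (m < sigma i)%N]%SET.
  apply/setP => i; rewrite /init /cgr_init /bind /tick /for_each /= !inE ffunE inE.
  by case: (a i).
have init_le : (init.2 <= c * (8 * d) * m)%N.
  rewrite /init /cgr_init /bind /tick /for_each /ret /=.
  rewrite [(\sum_(i in [set i | a i]%SET) _)%N]sum_nat_const.
  set U := [set i in _ | _]%SET.
  have : (#|U| <= m)%N.
    rewrite -cardm; apply: subset_leq_card; apply/fintype.subsetP => i.
    by rewrite !inE => /andP[].
  rewrite sum_nat_const cardm; move: #|U| => u um.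
  have h1 : (d * op_cost cm <= c * d * m)%N.
    by rewrite mulnC -mulnA leq_mul// leq_pmulr.
  have h2 : (m * op_cost cm <= c * d * m)%N.
    by rewrite mulnC leq_mul// (leq_trans hop)// leq_pmulr.
  have h3 : (u * op_cost cm <= c * d * m)%N.
    by apply: leq_trans h2; rewrite leq_mul2r um orbT.
  have h4 : (m * rank_cost cm d <= c * d * m)%N.
    by rewrite mulnC leq_mul.
  have -> : (c * (8 * d) * m = 8 * (c * d * m))%N by ring.
  by rewrite -mulnA; move: h1 h2 h3 h4; lia.
move: init pE uE init_le => [[st C] k0] /= pE uE init_le.
have := @cgr_loop_cost samples a st n pE uE.
case: (cgr_loop _ _ _ _ _ _ _) => st' k /= [_ _ kle].
set fin := (X in (_ + (_ + X.2))%N).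
have fin_le : (fin.2 <= c * (2 * d) * m)%N.
  rewrite /fin; case: ifP => _ //=; rewrite /bind /tick /for_each /ret /=.
  rewrite sum_nat_const cardm addn0.
  have h1 : (d * op_cost cm <= c * d * m)%N.
    by rewrite mulnC -mulnA leq_mul// leq_pmulr.
  have h2 : (m * op_cost cm <= c * d * m)%N.
    by rewrite mulnC leq_mul// (leq_trans hop)// leq_pmulr.
  have -> : (c * (2 * d) * m = 2 * (c * d * m))%N by ring.
  by move: h1 h2; lia.
rewrite mulnDr addnCA [leqRHS]addnC leq_add//.
apply: leq_trans (leq_add init_le fin_le) _.
rewrite -mulnDl -mulnDr -mulnDl leq_mul2r leq_mul2l leq_mul2r.
by rewrite !orbT.
Qed.

End CostBound.

(** * Optimal actions and exchanges of two arms *)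

Lemma is_action_tperm (d m : nat) (a : action d) (i j : 'I_d) :
  is_action m a -> is_action m [ffun k => a (tperm i j k)].
Proof.
move=> /eqP am; apply/eqP; rewrite -[RHS]am.
rewrite [RHS](reindex_inj (@perm_inj _ (tperm i j))) /=.
by apply: eq_bigr => k _; rewrite ffunE.
Qed.

(** Needed for [arg_minP], which asks for an admissible default value. *)
Lemma is_action_prefix (d m : nat) : (m <= d)%N ->
  is_action m [ffun i : 'I_d => (i < m)%N].
Proof.
move=> md; apply/eqP; under eq_bigr do rewrite ffunE.
rewrite -[RHS]card_ord -sum1_card [RHS](big_ord_widen _ (fun=> 1%N) md) [RHS]big_mkcond/=.
by apply: eq_bigr => i _; case: ltnP.
Qed.

Section BestAction.
Context {R : realType} (d m : nat) (eta : R) (L : 'I_d -> R).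
Hypothesis md : (m <= d)%N.

Lemma best_actionP r : is_action m (best_action m eta L r).
Proof. by rewrite /best_action; case: arg_minP; first exact: is_action_prefix. Qed.

Lemma best_action_min r b : is_action m b ->
  \sum_(i < d) (best_action m eta L r i)%:R * (eta * L i - r i) <=
  \sum_(i < d) (b i)%:R * (eta * L i - r i).
Proof.
rewrite /best_action; case: arg_minP; first exact: is_action_prefix.
by move=> a _ h mb; exact: h.
Qed.

Lemma best_action_rank r i (sigma : 'I_d -> nat) :
    0 < eta -> is_ranking L sigma -> best_action m eta L r i ->
  (#|[set j | (sigma j <= sigma i)%N & (r i < r j)%R]%SET| < m)%N.
Proof.
move=> eta0 [_ _ sigmaL] ai; rewrite ltnNge; apply/negP => mB.
set B := [set j | _ & _]%SET in mB.
set a := best_action m eta L r in ai.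
have /eqP am : is_action m a := best_actionP r.
(* Together with [i] the arms of [B] are more than [m], so they cannot all be played. *)
have [j jB naj] : exists2 j, j \in B & ~~ a j.
  apply/exists_inP; rewrite -negb_forall_in; apply/negP => /forall_inP BA.
  have : (i |: B)%SET \subset [set j | a j]%SET.
    by rewrite finset.subUset finset.sub1set inE ai; apply/fintype.subsetP => j /BA; rewrite inE.
  move=> /subset_leq_card; rewrite cardsU1 inE ltxx andbF add1n.
  rewrite [X in (_ <= X)%N](_ : _ = m) ?ltnNge ?mB//.
  rewrite -sum1dep_card [LHS]big_mkcond/= -[RHS]am.
  by apply: eq_bigr => k _; case: (a k).
move: jB; rewrite inE => /andP[ji rij].
have Lij : L j <= L i.
  by rewrite leNgt; apply/negP => /sigmaL; rewrite ltnNge ji.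
have ij : i != j by apply: contraNneq naj => <-.
have := best_action_min r (is_action_tperm i j (best_actionP r)).
rewrite -/a (reindex_inj (@perm_inj _ (tperm i j))) /=.
rewrite [leRHS](reindex_inj (@perm_inj _ (tperm i j))) /=.
apply/negP; rewrite -ltNge.
(* Outside [i] and [j] the two reindexed sums agree, and what remains is
   [eta * L j - r j < eta * L i - r i]. *)
rewrite [ltLHS](bigD1 j)//= [ltRHS](bigD1 j)//=.
rewrite ffunE tpermK tpermR (negbTE naj) ai mul0r mul1r add0r.
rewrite [ltLHS](bigD1 i)//= [X in _ < _ + X](bigD1 i)//=.
rewrite ffunE tpermK tpermL (negbTE naj) ai mul0r mul1r add0r.
rewrite (eq_bigr (fun k => (a k)%:R * (eta * L k - r k))); last first.
  by move=> k /andP[kj ki]; rewrite ffunE tpermK tpermD// eq_sym.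
rewrite [X in _ < _ + X](eq_bigr (fun k => (a k)%:R * (eta * L k - r k))).
  by have : eta * L j <= eta * L i; [rewrite ler_pM2l | lra].
by move=> k /andP[kj ki]; rewrite tpermD// eq_sym.
Qed.

End BestAction.

(** * Order statistics *)

Section KthLargest.
Context {R : realType} {d : nat}.
Implicit Types (r : 'I_d -> R) (S : {set 'I_d}).

(** By injectivity the list is strictly decreasing, so the entries that exceed the one of [i] are
    exactly those placed before it. *)
Lemma index_sort_desc r (s : seq 'I_d) i : injective r -> uniq s ->
    sorted (fun j k => r k <= r j) s -> i \in s ->
  index i s = count (fun j => r i < r j) s.
Proof.
move=> rinj; elim: s => // x s IH /= /andP[xs us] px.
have tr : transitive (fun j k : 'I_d => r k <= r j).
  by move=> a b c ba cb; exact: le_trans cb ba.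
have /allP xmin := order_path_min tr px.
rewrite inE; case: eqVneq => [->|ix] /= is_.
  rewrite ltxx add0n; apply/esym/eqP; rewrite -leqn0 leqNgt -has_count.
  by apply/hasPn => y /xmin; rewrite -leNgt.
rewrite IH// ?(path_sorted px)//.
have -> : r i < r x; last by [].
by rewrite lt_neqAle xmin// andbT; apply: contra_neq ix => /rinj.
Qed.

(** Positions in the sorted list start at 0 while [kth_largest] counts from 1, hence [t.+1]. *)
Lemma kth_largest_rank r S t i i0 : injective r -> i \in S ->
    #|[set k in S | r i < r k]%SET| = t ->
  kth_largest r S t.+1 i0 = i.
Proof.
move=> rinj iS <-; rewrite /kth_largest.
set e := (fun _ _ => _ : bool); set s := sort e (enum S).
have tot : total e by move=> x y; exact: le_total.
have is_ : i \in s by rewrite mem_sort mem_enum.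
have := @index_sort_desc r s i rinj _ (sort_sorted tot _) is_.
rewrite sort_uniq enum_uniq => /(_ isT); rewrite count_sort => iE.
rewrite -[RHS](nth_index i0 is_) iE /=; congr (nth i0 s _).
rewrite cardE -size_filter; congr size.
by rewrite /enum_mem -filter_predI; apply: eq_filter => k /=; rewrite !inE andbC.
Qed.

(** Since [i] and [j] both lie in [S], the transposition maps [S] to itself, and the value formerly
    at [i] keeps its rank at its new place [j]. *)
Lemma kth_largest_swap r S t i j i0 : injective r -> i \in S -> j \in S ->
    #|[set k in S | r i < r k]%SET| = t ->
  kth_largest (r \o tperm i j) S t.+1 i0 = j.
Proof.
move=> rinj iS jS rk; apply: kth_largest_rank => //.
  by apply: inj_comp => //; exact: perm_inj.
rewrite -[RHS]rk -(card_preimset _ (@perm_inj _ (tperm i j))); apply: eq_card => k.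
rewrite !inE /= tpermR; congr (_ && _); last by rewrite tpermK.
by case: tpermP => [->|->|//]; rewrite iS jS.
Qed.

End KthLargest.

Local Open Scope classical_set_scope.

(** * Independence of disjoint blocks of random variables *)

Section Independence.
Context {dT : measure_display} {T : measurableType dT} {R : realType}.
Variable P : probability T R.

(** For fixed [W] both sides are finite measures in [A]. They agree on [G], which is stable under
    intersection and contains the whole space, so they agree on the generated sigma-algebra. *)
Lemma independent_generated (G : set (set T)) (W : set T) :
    G `<=` measurable -> setI_closed G -> G setT -> measurable W ->
    (forall A, G A -> P (A `&` W) = (P A * P W)%E) ->
  forall A, <<s G >> A -> P (A `&` W) = (P A * P W)%E.
Proof.
move=> Gm GI GT mW GW A sA.
have [c c0 PW] : exists2 c, 0 <= c & P W = c%:E.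
  by exists (fine (P W)); [rewrite fine_ge0 | rewrite fineK// fin_num_measure].
pose m1 := mrestr P mW; pose m2 := mscale (NngNum c0) P.
suff : m1 A = m2 A by rewrite muleC PW.
apply: (@g_sigma_algebra_measure_unique _ _ _ G Gm (fun=> setT)) => //.
- by apply/seteqP; split => // x _; exists 0%N.
- by move=> B /GW; rewrite muleC PW.
- by move=> _; rewrite /m1 /= /mrestr setTI ltey_eq fin_num_measure.
Qed.

(** The systems are replaced by their generated sigma-algebras one at a time; the induction is on
    the number [n] of those already replaced. *)
Lemma independent_systems (G : nat -> set (set T)) (N : nat) :
    (forall k, G k `<=` measurable) -> (forall k, setI_closed (G k)) ->
    (forall k, G k setT) ->
    (forall E, (forall k, G k (E k)) ->
       P (\big[setI/setT]_(k < N) E k) = (\prod_(k < N) P (E k))%E) ->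
  forall E, (forall k, <<s G k >> (E k)) ->
    P (\big[setI/setT]_(k < N) E k) = (\prod_(k < N) P (E k))%E.
Proof.
move=> Gm GI GT GN.
have sGm k A : <<s G k >> A -> measurable A.
  by apply: smallest_sub => //; exact: sigma_algebra_measurable.
suff H n E : (n <= N)%N ->
    (forall k, if (k < n)%N then <<s G k >> (E k) else G k (E k)) ->
    P (\big[setI/setT]_(k < N) E k) = (\prod_(k < N) P (E k))%E.
  move=> E sE.
  (* From [N] on the events must belong to [G k] itself, so they are replaced by the whole space. *)
  pose E' k := if (k < N)%N then E k else setT.
  rewrite (eq_bigr (fun k : 'I_N => E' k)); last by move=> k _; rewrite /E' ltn_ord.
  rewrite [RHS](eq_bigr (fun k : 'I_N => P (E' k))); last first.
    by move=> k _; rewrite /E' ltn_ord.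
  apply: (H N) => // k; rewrite /E'. case: (k < N)%N; first exact: sE.
  exact: GT.
elim: n E => [|n IH] E nN sE; first by apply: GN => k; exact: sE k.
pose o := Ordinal nN.
pose W := \big[setI/setT]_(k < N | k != o) E k.
have mW : measurable W.
  apply: bigsetI_measurable => k _; have := sE k; case: ifP => _; first exact: sGm.
  exact: Gm.
have IHB B : G n B ->
    P (B `&` W) = (P B * \prod_(k < N | k != o) P (E k))%E.
  move=> GB; pose E' k := if k == n then B else E k.
  have : P (\big[setI/setT]_(k < N) E' k) = (\prod_(k < N) P (E' k))%E.
    apply: (IH E' (ltnW nN)) => k; rewrite /E'; have := sE k.
    case: eqVneq => [->|kn]; first by rewrite ltnn.
    by rewrite ltnS leq_eqVlt (negbTE kn).
  have ko (k : 'I_N) : k != o -> E' k = E k by move=> ko; rewrite /E' ifN.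
  rewrite (bigD1 o)//= [X in _ = X -> _](bigD1 o)//= (eq_bigr _ ko).
  have Pko (k : 'I_N) : k != o -> P (E' k) = P (E k) by move=> /ko ->.
  by rewrite [X in _ = (_ * X)%E -> _](eq_bigr _ Pko) {1 2}/E' eqxx.
have PW : P W = (\prod_(k < N | k != o) P (E k))%E.
  by have := IHB _ (GT n); rewrite setTI probability_setT mul1e.
rewrite (bigD1 o)//= [RHS](bigD1 o)//= -PW.
apply: (independent_generated (Gm n)) => //.
  by move=> B /IHB; rewrite PW.
by have := sE n; rewrite ltnS leqnn.
Qed.

Lemma independent_seq (I : choiceType) (F : I -> set (set T)) (s : seq I)
    (E : I -> set T) : independent_events P F -> uniq s ->
    (forall x, F x (E x)) ->
  P (\big[setI/setT]_(x <- s) E x) = (\prod_(x <- s) P (E x))%E.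
Proof.
move=> iF us FE; have := iF [fset x in s]%fset E (fun x _ => FE x).
rewrite bigcap_fset.
have ps : perm_eq [fset x in s]%fset s.
  by apply: uniq_perm => // x; rewrite inE.
by rewrite (perm_big _ ps) [X in _ = X](perm_big _ ps).
Qed.

(** Rectangles over the indices of [s]: an intersection-stable generator of their joint
    sigma-algebra. The family [E] is total, so that intersections can be taken index by index. *)
Definition joint_events (I : eqType) (F : I -> set (set T)) (s : seq I) :
    set (set T) :=
  [set A | exists2 E, (forall x, F x (E x)) & A = \big[setI/setT]_(x <- s) E x].

Section Blocks.
Context (I : choiceType) (F : I -> set (set T)).
Hypotheses (FT : forall x, F x setT) (FI : forall x, setI_closed (F x)).
Hypothesis Fm : forall x, F x `<=` measurable.

Lemma joint_events_measurable s : joint_events F s `<=` measurable.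
Proof.
by move=> _ [E FE ->]; apply: bigsetI_measurable => x _; exact: Fm (FE x).
Qed.

Lemma joint_eventsI s : setI_closed (joint_events F s).
Proof.
move=> _ _ [E FE ->] [E' FE' ->]; exists (fun x => E x `&` E' x).
  by move=> x; exact: FI.
by rewrite big_split.
Qed.

Lemma joint_eventsT s : joint_events F s setT.
Proof. by exists (fun=> setT) => //; rewrite big1. Qed.

Lemma joint_events_sub s x A : uniq s -> x \in s -> F x A -> joint_events F s A.
Proof.
move=> us xs FA; exists (fun y => if y == x then A else setT).
  by move=> y; case: eqVneq => [->|].
rewrite (bigD1_seq x)//= eqxx big1 ?setIT// => y yx.
by rewrite (negbTE yx).
Qed.

(** The map [b] sends an index to the number of its block, which encodes that the blocks are
    disjoint. *)
Lemma independent_blocks (l : nat -> seq I) (b : I -> nat) (N : nat)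
    (E : nat -> set T) :
    independent_events P F -> (forall k, uniq (l k)) ->
    (forall k x, x \in l k -> b x = k) ->
    (forall k, <<s joint_events F (l k) >> (E k)) ->
  P (\big[setI/setT]_(k < N) E k) = (\prod_(k < N) P (E k))%E.
Proof.
move=> iF ul lb; apply: independent_systems.
- by move=> k; exact: joint_events_measurable.
- by move=> k; exact: joint_eventsI.
- by move=> k; exact: joint_eventsT.
- move=> {}E /(_ _)/cid2-/all_sig2[E' FE' EE'].
  (* The families chosen for the separate blocks are glued into one, to which independence applies
     along the concatenation of the blocks. *)
  pose E'' x := E' (b x) x.
  have EB k : E k = \big[setI/setT]_(x <- l k) E'' x.
    rewrite EE' big_seq [RHS]big_seq; apply: eq_bigr => x xl.
    by rewrite /E'' (lb k).
  have FE'' x : F x (E'' x) by exact: FE'.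
  under eq_bigr do rewrite EB.
  under [RHS]eq_bigr do rewrite EB (independent_seq iF (ul _) FE'').
  rewrite -!(big_mkord xpredT (fun k => \big[_/_]_(x <- l k) _)).
  rewrite -(big_map l xpredT (fun s => \big[setI/setT]_(x <- s) E'' x)).
  rewrite -[in RHS](big_map l xpredT (fun s => \prod_(x <- s) P (E'' x))%E).
  rewrite -!big_flatten /=; apply: (independent_seq iF _ FE'').
  (* The concatenation has no repetition: [b] separates the last block from the earlier ones. *)
  rewrite /index_iota ?subn0; elim: (N) => // n IH.
  rewrite -addn1 iotaD map_cat flatten_cat cat_uniq IH /= cats0 ul andbT.
  apply/hasPn => x /lb; apply: contra_eqN => /flatten_mapP[k + /lb ->].
  by rewrite mem_iota => /andP[_ kn]; rewrite neq_ltn kn.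
Qed.

End Blocks.

End Independence.

(** * Laws of random vectors *)

Section TupleLaw.
Context {dT : measure_display} {T : measurableType dT} {R : realType}.
Variable P : probability T R.

Definition vec (d : nat) (Y : 'I_d -> T -> R) (x : T) : d.-tuple R :=
  [tuple Y i x | i < d].

Lemma measurable_vec (d : nat) (Y : 'I_d -> {RV P >-> R}) :
  measurable_fun setT (vec Y).
Proof.
apply/measurable_fun_tnthP => i.
rewrite (_ : _ \o _ = Y i); first exact: measurable_funPT.
by apply/funext => x /=; rewrite tnth_mktuple.
Qed.

(** Here [vec Y] is viewed as a measurable map for the sigma-algebra generated by [G], which can be
    checked on each coordinate. *)
Lemma sub_generated_sigma_of_vec (d : nat) (Y : 'I_d -> {RV P >-> R})
    (G : set (set T)) (B : set (d.-tuple R)) :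
    (forall i, sigma_of (Y i) `<=` <<s G >>) -> measurable B ->
  <<s G >> (vec Y @^-1` B).
Proof.
move=> YG mB.
have mv : measurable_fun [set: g_sigma_algebraType G] (vec Y).
  apply/measurable_fun_tnthP => i _ A mA; apply: YG.
  exists A => //; congr (_ `&` _); apply/funext => x /=.
  by rewrite tnth_mktuple.
by have := mv measurableT _ mB; rewrite setTI.
Qed.

(** Rectangles, unlike the preimages under single coordinates, are stable under intersection, as
    uniqueness of measures requires. *)
Lemma measurable_tuple_rectangles (d : nat) :
  @measurable _ (d.-tuple R) =
  <<s [set B | exists2 A : 'I_d -> set R, (forall i, measurable (A i)) &
         B = \big[setI/setT]_(i < d) (fun v => tnth v i) @^-1` A i] >>.
Proof.
apply/seteqP; split; last first.
  apply: smallest_sub; first exact: sigma_algebra_measurable.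
  move=> _ [A mA ->]; apply: bigsetI_measurable => i _.
  by rewrite -[X in measurable X]setTI; exact: measurable_tnth.
apply: smallest_sub; first exact: smallest_sigma_algebra.
move=> B; rewrite -bigcup_seq => -[i _ [A mA <-]]; apply: sub_sigma_algebra.
exists (fun j => if j == i then A else setT) => [j|]; first by case: eqVneq.
by rewrite (bigD1 i)//= eqxx setTI big1 ?setIT// => j /negbTE ->.
Qed.

Lemma vec_law_unique (d : nat) (Y Z : 'I_d -> {RV P >-> R}) :
    (forall A : 'I_d -> set R, (forall i, measurable (A i)) ->
       P (\big[setI/setT]_(i < d) Y i @^-1` A i) =
       P (\big[setI/setT]_(i < d) Z i @^-1` A i)) ->
  forall B, measurable B -> P (vec Y @^-1` B) = P (vec Z @^-1` B).
Proof.
move=> YZ B mB.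
have pre (X : 'I_d -> {RV P >-> R}) (A : 'I_d -> set R) :
    vec X @^-1` (\big[setI/setT]_(i < d) (fun v => tnth v i) @^-1` A i) =
    \big[setI/setT]_(i < d) X i @^-1` A i.
  rewrite (big_morph (fun C => vec X @^-1` C) (@preimage_setI _ _ _) (preimage_setT _)).
  apply: eq_bigr => i _; apply/seteqP; split => x /=.
    by rewrite /vec tnth_mktuple.
  by rewrite /vec tnth_mktuple.
pose mY : {mfun T >-> d.-tuple R} := mfun_Sub (mem_set (measurable_vec Y)).
pose mZ : {mfun T >-> d.-tuple R} := mfun_Sub (mem_set (measurable_vec Z)).
apply: (@measure_unique _ _ _ _ (fun=> setT) (measurable_tuple_rectangles d)
  _ _ _ (distribution P mY) (distribution P mZ)) => //.
- move=> _ _ [A mA ->] [A' mA' ->]; exists (fun i => A i `&` A' i).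
    by move=> i; exact: measurableI.
  by rewrite -big_split; apply: eq_bigr => i _; rewrite preimage_setI.
- by move=> _; exists (fun=> setT) => //; rewrite big1// => i _; exact: preimage_setT.
- by apply/seteqP; split => // x _; exists 0%N.
- by move=> _ [A mA ->]; have := YZ A mA; rewrite -!pre.
- by move=> _; rewrite ltey_eq fin_num_measure.
Qed.

End TupleLaw.

(** * Absence of ties *)

Section Atomless.
Context {R : realType} (D : probability R R).
Hypothesis Dc : continuous_distribution D.

(** For [y < x] the distribution function at [y] is at most its value at [x] minus the mass of [x].
    Letting [y] tend to [x] from the left, continuity forces this mass to vanish. *)
Lemma continuous_distribution_atomless x : D [set x] = 0%E.
Proof.
pose f y := D `]-oo, y].
have Df y : y < x -> (f y + D [set x] <= f x)%E.
  move=> yx; rewrite -measureU//.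
    apply: le_measure; rewrite ?inE//; first exact: measurableU.
    move=> z [|->] /=; rewrite !in_itv /= ?lexx// => zy.
    by rewrite (le_trans zy)// ltW.
  apply/seteqP; split => // z [/= + zx]; rewrite zx in_itv /= => xy.
  by have := lt_le_trans yx xy; rewrite ltxx.
have fx : f y @[y --> x^'-] --> f x by apply: cvg_at_left_filter; exact: Dc.
have : (f x <= f x - D [set x])%E.
  apply: cvge_le fx; near=> y.
  rewrite leeBrDr ?fin_num_measure//; apply: Df; near: y.
  exact: nbhs_left_lt.
rewrite leeBrDr ?fin_num_measure// -[leRHS]adde0 leeD2lE ?fin_num_measure//.
by move=> Dx; apply/eqP; rewrite eq_le Dx measure_ge0.
Unshelve. all: by end_near. Qed.

Context {dT : measure_display} {T : measurableType dT}.
Variable P : probability T R.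

(** The hypothesis identifies the joint law with [D \x D] on rectangles, hence everywhere; the
    diagonal is null because its sections are single points. *)
Lemma no_ties (X Y : {RV P >-> R}) :
    (forall A B, measurable A -> measurable B ->
      P (X @^-1` A `&` Y @^-1` B) = (D A * D B)%E) ->
  P [set x | X x = Y x] = 0%E.
Proof.
move=> XY.
have mXY : measurable_fun setT (fun x => (X x, Y x)) by exact: measurable_fun_pair.
pose mf : {mfun T >-> (R * R)%type} := mfun_Sub (mem_set mXY).
have mdiag : measurable [set z : R * R | z.1 = z.2].
  rewrite (_ : [set _ | _] = [set z : R * R | z.1 == z.2]).
    have : measurable_fun setT (fun z : R * R => z.1 == z.2).
      exact: measurable_fun_eqr.
    by move=> /(_ measurableT [set true]); rewrite setTI; apply.
  by apply/seteqP; split => z /eqP.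
have : (D \x D)%E [set z : R * R | z.1 = z.2] = 0%E.
  rewrite /product_measure1 integral0_eq// => x _ /=.
  rewrite (_ : xsection _ _ = [set x]) ?continuous_distribution_atomless//.
  by apply/seteqP; split => y; rewrite /xsection /= inE/= => ->.
rewrite (@product_measure_unique _ _ _ _ _ _ _ (distribution P mf))//.

Qed.

End Atomless.

(** * Measurability of argmin and selection *)

Section FiniteTables.
Context {dV : measure_display} {V : measurableType dV}.

(** The table takes finitely many values, each on a finite intersection of measurable sets. A result
    that depends only on finitely many comparisons is thus measurable, whatever the algorithm
    computing it. *)
Lemma measurable_finite_table (J : finType) (tab : V -> {ffun J -> bool})
    (f : V -> bool) :
    (forall j, measurable [set v | tab v j]) ->
    (forall v v', tab v = tab v' -> f v = f v') ->
  measurable [set v | f v].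
Proof.
move=> mtab ftab.
rewrite (_ : [set v | f v] =
    \bigcup_(t in [set t | exists2 v, tab v = t & f v]) [set v | tab v = t]).
  apply: fin_bigcup_measurable => [|t _]; first exact: finite_finset.
  rewrite (_ : [set v | tab v = t] =
    \bigcap_j (if t j then [set v | tab v j] else ~` [set v | tab v j])).
    apply: fin_bigcap_measurable => [|j _]; first exact: finite_finset.
    by case: ifP => _ //; exact: measurableC.
  apply/seteqP; split => [v <- j _ /=|v vt]; first by case: ifPn => [|/negP].
  by apply/ffunP => j; have := vt j I; case: (t j) => //= /negP/negbTE.
apply/seteqP; split => [v fv|v [t [v' tv' fv'] vt]] /=.
  by exists (tab v) => //; exists v.
by rewrite /= (ftab v v')// tv'.
Qed.

Context {R : realType} {d : nat} (Y : V -> 'I_d -> R).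
Hypothesis mY : forall i, measurable_fun setT (fun v => Y v i).

Lemma measurable_best_action m eta (L : 'I_d -> R) i :
  measurable [set v | best_action m eta L (Y v) i].
Proof.
pose F v (a : action d) := \sum_(k < d) (a k)%:R * (eta * L k - Y v k).
(* The argmin is determined by the comparisons between the costs of all pairs of actions. *)
pose tab v := [ffun ab : action d * action d => F v ab.1 <= F v ab.2].
apply: (@measurable_finite_table _ tab) => [[a b]|v v' vv'].
  rewrite (_ : [set v | _] = (fun v => F v a <= F v b) @^-1` [set true]).
    have : measurable_fun setT (fun v => F v a <= F v b).
      by apply: measurable_fun_ler;
        apply: measurable_sum => k; apply: measurable_funM => //;
        apply: measurable_funB.
    by move=> /(_ measurableT [set true]); rewrite setTI; apply.
  by apply/seteqP; split => v /=; rewrite ffunE.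
congr (fun_of_fin _ i); rewrite /best_action /Order.arg_min /extremum.
congr odflt; apply: eq_pick => a /=; congr (_ && _).
apply: eq_forallb => b; congr (_ ==> _).
by have := congr1 (fun t : {ffun _} => t (a, b)) vv'; rewrite !ffunE.
Qed.

Lemma measurable_kth_largest (S : {set 'I_d}) t i0 j :
  measurable [set v | kth_largest (Y v) S t i0 = j].
Proof.
(* Sorting is determined by the comparisons between all pairs of entries. *)
pose tab v := [ffun ab : 'I_d * 'I_d => Y v ab.2 <= Y v ab.1].
rewrite (_ : [set v | _] = [set v | kth_largest (Y v) S t i0 == j]); last first.
  by apply/seteqP; split => v /= /eqP.
apply: (@measurable_finite_table _ tab) => [[a b]|v v' vv'].
  rewrite (_ : [set v | _] = (fun v => Y v b <= Y v a) @^-1` [set true]).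
    have : measurable_fun setT (fun v => Y v b <= Y v a).
      exact: measurable_fun_ler.
    by move=> /(_ measurableT [set true]); rewrite setTI; apply.
  by apply/seteqP; split => v /=; rewrite ffunE.
congr (_ == _); rewrite /kth_largest; congr nth; congr sort.
apply/funext => a; apply/funext => b.
by have := congr1 (fun t : {ffun _} => t (a, b)) vv'; rewrite !ffunE.
Qed.

End FiniteTables.

(** The index exchanged with [i] is itself random, so the event is split according to its finitely
    many values. *)
Lemma measurable_swapped_best_action {dV : measure_display}
    {V : measurableType dV} (R : realType) (d m : nat) (Y : V -> 'I_d -> R)
    (eta : R) (L : 'I_d -> R) (S : {set 'I_d}) t i :
    (forall i, measurable_fun setT (fun v => Y v i)) ->
  measurable
    [set v | best_action m eta L (Y v \o tperm i (kth_largest (Y v) S t i)) i].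
Proof.
move=> mY; rewrite (_ : [set v | _] = \bigcup_j
   ([set v | kth_largest (Y v) S t i = j] `&`
    [set v | best_action m eta L (Y v \o tperm i j) i])).
  apply: fin_bigcup_measurable => [|j _]; first exact: finite_finset.
  apply: measurableI; first exact: measurable_kth_largest.
  by apply: measurable_best_action => k; exact: mY.
apply/seteqP; split => [v vi|v [j _ [/= -> //]]].
by exists (kth_largest (Y v) S t i).
Qed.

(** * Success probability of the exchange step *)

Section SwapProbability.
Context {dT : measure_display} {T : measurableType dT} {R : realType}.
Variables (P : probability T R) (D : probability R R).

Definition iid_sample (d : nat) (X : 'I_d -> {RV P >-> R}) : Prop :=
  forall A : 'I_d -> set R, (forall i, measurable (A i)) ->
    P (\big[setI/setT]_(i < d) X i @^-1` A i) = (\prod_(i < d) D (A i))%E.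

Lemma iid_sample_perm (d : nat) (X : 'I_d -> {RV P >-> R}) (s : {perm 'I_d}) :
  iid_sample X -> iid_sample (fun i => X (s i)).
Proof.
move=> iX A mA.
rewrite (reindex_inj (@perm_inj _ s^-1)) [RHS](reindex_inj (@perm_inj _ s^-1)) /=.
rewrite -(iX (fun i => A (s^-1%g i)))//; congr (P _).
by apply: eq_bigr => i _; rewrite permKV.
Qed.

Lemma iid_sample_law (d : nat) (X Y : 'I_d -> {RV P >-> R}) B :
    iid_sample X -> iid_sample Y -> measurable B ->
  P (vec X @^-1` B) = P (vec Y @^-1` B).
Proof. by move=> iX iY; apply: vec_law_unique => A mA; rewrite iX// iY. Qed.

Lemma iid_sample_pair (d : nat) (X : 'I_d -> {RV P >-> R}) i j A B :
    iid_sample X -> i != j -> measurable A -> measurable B ->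
  P (X i @^-1` A `&` X j @^-1` B) = (D A * D B)%E.
Proof.
move=> iX ij mA mB.
pose C k := if k == i then A else if k == j then B else setT.
have Ci : C i = A by rewrite /C eqxx.
have Cj : C j = B by rewrite /C eq_sym (negbTE ij) eqxx.
have Ck k : (k != i) && (k != j) -> C k = setT.
  by rewrite /C => /andP[/negbTE -> /negbTE ->].
have mC k : measurable (C k) by rewrite /C; case: ifP => // _; case: ifP.
have := iX C mC; have ji : j != i by rewrite eq_sym.
rewrite (bigD1 i)//= (bigD1 j)//= big1 ?setIT ?Ci ?Cj => [->|k /Ck ->]; last first.
  exact: preimage_setT.
rewrite (bigD1 i)//= (bigD1 j)//= big1 ?mule1 => [|k /Ck ->]; last first.
  exact: probability_setT.
by rewrite Ci Cj.
Qed.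

Lemma iid_sample_no_ties (d : nat) (X : 'I_d -> {RV P >-> R}) :
    continuous_distribution D -> iid_sample X ->
  exists N, [/\ measurable N, P N = 0%E &
    forall x, ~ N x -> injective (fun i => X i x)].
Proof.
move=> cD iX.
have mE i j : measurable [set x | X i x = X j x].
  rewrite (_ : [set x | _] = (fun x => X i x == X j x) @^-1` [set true]).
    by rewrite -[X in measurable X]setTI; exact: measurable_fun_eqr.
  by apply/seteqP; split => x /= /eqP.
pose E (ij : 'I_d * 'I_d) :=
  if ij.1 == ij.2 then set0 else [set x | X ij.1 x = X ij.2 x].
have mE' ij : measurable (E ij).
  by rewrite /E; case: ifP => _; [exact: measurable0|exact: mE].
have PE ij : P (E ij) = 0%E.
  rewrite /E; case: eqVneq => [_|ij12]; first exact: measure0.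
  by apply: (no_ties cD) => A B mA mB; exact: iid_sample_pair.
exists (\big[setU/set0]_(ij <- enum {: 'I_d * 'I_d}) E ij); split.
- exact: bigsetU_measurable.
- elim: (enum _) => [|ij s IH]; first by rewrite big_nil measure0.
  have ms : measurable (\big[setU/set0]_(ij <- s) E ij) by exact: bigsetU_measurable.
  by rewrite big_cons setUC (measureU0 ms (mE' ij) (PE ij)).
- move=> x; rewrite -bigcup_seq => nE i j Xij; apply: contrapT => /eqP ij.
  by apply: nE; exists (i, j); rewrite /= ?mem_enum// /E /= (negbTE ij).
Qed.

Context (d m : nat) (eta : R) (L : 'I_d -> R) (sigma : 'I_d -> nat).
Hypotheses (m_gt0 : (1 <= m)%N) (md : (m <= d)%N) (eta0 : 0 < eta).
Hypotheses (sigmaP : is_ranking L sigma) (cD : continuous_distribution D).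
Variable X : 'I_d -> {RV P >-> R}.
Hypothesis iX : iid_sample X.

Let a (x : T) := best_action m eta L (fun i => X i x).
Let S i := [set j | (sigma j <= sigma i)%N]%SET.
Let swapped i t x :=
  best_action m eta L
    ((fun j => X j x) \o tperm i (kth_largest (fun j => X j x) (S i) t i)) i.

(** An injection into [1..d] is a bijection, so every rank up to [sigma i] is attained; ranks are
    shifted by one to land in ['I_d]. *)
Lemma card_rank_le i : (sigma i <= #|S i|)%N.
Proof.
case: sigmaP => sinj srange _.
have sd k : ((sigma k).-1 < d)%N.
  by have /andP[] := srange k; case: (sigma k).
pose f k : 'I_d := Ordinal (sd k).
have finj : injective f.
  move=> j k /(congr1 val) /= jk; apply: sinj; move: jk.
  by have /andP[+ _] := srange j; have /andP[+ _] := srange k; lia.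
have [g fK gK] := injF_bij finj.
have -> : S i = f @^-1: [set k : 'I_d | (k < sigma i)%N]%SET.
  apply/setP => j; rewrite !inE /=.
  by have /andP[+ _] := srange j; case: (sigma j).
rewrite card_preimset// -sum1dep_card.
rewrite -(big_ord_widen d (fun=> 1%N)) ?sum1_card ?card_ord//.
by have /andP[] := srange i.
Qed.

Lemma measurable_top_rank i t :
  measurable [set x | a x i /\
    #|[set k in S i | X i x < X k x]%SET| = t /\ injective (fun j => X j x)].
Proof.
pose tab x := [ffun kl : 'I_d * 'I_d => X kl.2 x <= X kl.1 x].
pose f x := (#|[set k in S i | X i x < X k x]%SET| == t) &&
  [forall k, forall l, (X k x == X l x) ==> (k == l)].
rewrite (_ : [set x | _] = [set x | a x i] `&` [set x | f x]).
  apply: measurableI.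
    by apply: measurable_best_action => k; exact: measurable_funPT.
  apply: (@measurable_finite_table _ _ _ tab) => [[k l]|x y xy].
    rewrite (_ : [set x | _] = (fun x => X l x <= X k x) @^-1` [set true]).
      by rewrite -[X in measurable X]setTI; exact: measurable_fun_ler.
    by apply/seteqP; split => x /=; rewrite ffunE.
  have le_xy k l : (X k x <= X l x) = (X k y <= X l y).
    by have := congr1 (fun t : {ffun _} => t (l, k)) xy; rewrite !ffunE.
  rewrite /f; congr (_ && _).
    by congr (_ == _); apply: eq_card => k; rewrite !inE !ltNge le_xy.
  apply: eq_forallb => k; apply: eq_forallb => l.
  by rewrite [X k x == _]eq_le [X k y == _]eq_le !le_xy.
apply/seteqP; split => x /=.
  move=> [ax [rk inj]]; split => //; apply/andP; split; first exact/eqP.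
  by apply/forallP => k; apply/forallP => l; apply/implyP => /eqP/inj ->.
move=> [ax /andP[/eqP rk /forallP inj]]; do 2?split => //.
by move=> k l kl; have /forallP/(_ l)/implyP := inj k; move=> /(_ (introT eqP kl))/eqP.
Qed.

(** This is [sigma_i w_i <= m q_i] with the average over [theta] written as a sum: [t.+1] runs
    through the values [1..m]. *)
Lemma swapped_prob i :
  ((sigma i)%:R%:E * P [set x | a x i] <=
   \sum_(t < m) P [set x | swapped i t.+1 x])%E.
Proof.
pose B t := [set x | a x i /\
    #|[set k in S i | X i x < X k x]%SET| = t /\ injective (fun j => X j x)].
have mB t : measurable (B t) by exact: measurable_top_rank.
have ma : measurable [set x | a x i].
  by apply: measurable_best_action => k; exact: measurable_funPT.
(* Outside the null set of ties, a played [i] has fewer than [m] larger entries in [S i], so it lies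
   in some [B t] with [t < m]. *)
have aB : (P [set x | a x i] <= \sum_(t < m) P (B t))%E.
  rewrite -(@measure_bigsetU_ord _ _ _ P m xpredT B)//; last first.
    by move=> s t _ _ [x [[_ [sE _]] [_ [tE _]]]]; apply/val_inj; rewrite /= -sE -tE.
  have [N [mN N0 Ninj]] := iid_sample_no_ties cD iX.
  have mBs : measurable (\big[setU/set0]_(t < m) B t) by exact: bigsetU_measurable.
  apply: (@le_trans _ _ (P ((\big[setU/set0]_(t < m) B t) `|` N))); last first.
    by rewrite (measureU0 mBs mN N0).
  apply: le_measure; rewrite ?inE//; first exact: measurableU.
  move=> x ax; have [Nx|Nx] := pselect (N x); [by right|left].
  rewrite -bigcup_mkord; exists #|[set k in S i | X i x < X k x]%SET|.
    have := best_action_rank md eta0 sigmaP ax.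
    by congr (_ < _)%N; apply: eq_card => k; rewrite !inE.
  by split => //; split => //; exact: Ninj.
pose V j t := [set v : d.-tuple R | kth_largest (tnth v) (S i) t i = j /\
   best_action m eta L (tnth v \o tperm i j) i].
have mV j t : measurable (V j t).
  apply: measurableI; first by apply: measurable_kth_largest => k; exact: measurable_tnth.
  by apply: measurable_best_action => k; exact: measurable_tnth.
(* Exchanging the coordinates [i] and [j] preserves the law of the sample and carries [B t] into the
   event [V j t.+1]. *)
have BV (t : 'I_m) j : j \in S i -> (P (B t) <= P (vec X @^-1` V j t.+1))%E.
  move=> jS.
  rewrite (@iid_sample_law _ X (fun k => X (tperm i j k)))//; last exact: iid_sample_perm.
  apply: le_measure; rewrite ?inE//.
    rewrite -[X in measurable X]setTI; exact: measurable_vec.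
  move=> x [ai [rk inj]]; rewrite /vec /V /=.
  have -> : tnth [tuple X (tperm i j k) x | k < d] = (fun k => X k x) \o tperm i j.
    by apply/funext => k; rewrite tnth_mktuple.
  split; first by apply: kth_largest_swap => //; rewrite inE.
  rewrite (_ : _ \o tperm i j = fun k => X k x)//.
  by apply/funext => k /=; rewrite tpermK.
(* For fixed [t] these events are disjoint, as each determines [j], and each implies that the
   exchange succeeds. *)
have VS (t : 'I_m) : (\sum_(j in S i) P (vec X @^-1` V j t.+1) <=
    P [set x | swapped i t.+1 x])%E.
  rewrite -(@measure_bigsetU_ord _ _ _ P d (mem (S i)) (fun j => vec X @^-1` V j t.+1)).
  - apply: le_measure; rewrite ?inE.
    + apply: bigsetU_measurable => j _.
      by rewrite -[X in measurable X]setTI; exact: measurable_vec.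
    + by apply: (@measurable_swapped_best_action _ _ _ _ _ (fun x j => X j x)).
    + apply: (big_ind (fun A => A `<=` _)) => [|A A' AS A'S|j _]; first exact: sub0set.
        by rewrite classical_sets.subUset.
      move=> x [/= + +]; rewrite (_ : tnth _ = fun k => X k x); last first.
        by apply/funext => k; rewrite tnth_mktuple.
      by rewrite /swapped => ->.
  - by move=> j; rewrite -[X in measurable X]setTI; exact: measurable_vec.
  - by move=> j k _ _ [x [[<- _] [<- _]]].
apply: (@le_trans _ _ ((sigma i)%:R%:E * \sum_(t < m) P (B t))%E).
  by rewrite lee_pmul2l// lte_fin ltr0n; have [_ /(_ i)/andP[]] := sigmaP.
rewrite ge0_sume_distrr; last by move=> t _; exact: measure_ge0.
apply: lee_sum => t _; apply: le_trans (VS t).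
(* There are at least [sigma i] choices of [j], each contributing at least [P (B t)]. *)
apply: (@le_trans _ _ (\sum_(j in S i) P (B t))%E); last first.
  by apply: lee_sum => j jS; exact: BV.
have -> : P (B t) = (fine (P (B t)))%:E by rewrite fineK// fin_num_measure.
rewrite sumEFin -EFinM lee_fin sumr_const -[leRHS]mulr_natl ler_wpM2r ?fine_ge0//.
by rewrite ler_nat card_rank_le.
Qed.

End SwapProbability.

(** * Sums over ranks, harmonic and geometric sums *)

Lemma sum_ranking (R : realType) (d : nat) (L : 'I_d -> R) (sigma : 'I_d -> nat)
    (g : nat -> R) : is_ranking L sigma ->
  \sum_(i < d) g (sigma i) = \sum_(k < d) g k.+1.
Proof.
move=> [sinj srange _].
have sK k : (sigma k).-1.+1 = sigma k.
  by have /andP[] := srange k; case: (sigma k).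
have sd k : ((sigma k).-1 < d)%N by rewrite sK; have /andP[] := srange k.
pose f k : 'I_d := Ordinal (sd k).
have finj : injective f.
  by move=> j k /(congr1 val) /= jk; apply: sinj; rewrite -sK jk sK.
by rewrite [RHS](reindex_inj finj); apply: eq_bigr => k _; rewrite /= sK.
Qed.

(** Induction on [d] starting at [d = m], where all terms are 1. The step is
    [1 / (d + 1) <= ln ((d + 1) / d)], which follows from [ln (1 + x) <= x] at
    [x = - 1 / (d + 1)]. *)
Lemma truncated_harmonic_le (R : realType) (m d : nat) :
    (1 <= m)%N -> (m <= d)%N ->
  \sum_(k < d) (if (m < k.+1)%N then m%:R / k.+1%:R else 1) <=
  m%:R + m%:R * ln (d%:R / m%:R) :> R.
Proof.
move=> m1; elim: d => [|d IH]; first by rewrite leqn0 => /eqP m0; rewrite m0 in m1.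
have m0 : 0 < m%:R :> R by rewrite ltr0n.
rewrite leq_eqVlt => /predU1P[md|]; last rewrite ltnS => md.
  rewrite -md divff ?gt_eqF// ln1 mulr0 addr0 (eq_bigr (fun=> 1)).
    by rewrite sumr_const card_ord.
  by move=> k _; rewrite ltnNge ltn_ord.
rewrite big_ord_recr /= ltnS md.
have d0 : 0 < d%:R :> R by rewrite ltr0n (leq_trans m1).
have dS0 : 0 < d.+1%:R :> R by rewrite ltr0n.
have le_ln : d.+1%:R^-1 <= ln (d.+1%:R / m%:R) - ln (d%:R / m%:R) :> R.
  rewrite -ln_div ?posrE ?divr_gt0//.
  have -> : d.+1%:R / m%:R / (d%:R / m%:R) = (d%:R / d.+1%:R)^-1 :> R.
    by field; rewrite !gt_eqF.
  rewrite lnV ?posrE ?divr_gt0// lerNr.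
  have -> : d%:R / d.+1%:R = 1 + - d.+1%:R^-1 :> R.
    by rewrite -natr1; field; rewrite natr1 gt_eqF.
  by apply: le_ln1Dx; rewrite ltrN2 invf_lt1// ltr1n ltnS (leq_trans m1).
apply: le_trans (lerD (IH md) (ler_wpM2l (ltW m0) le_ln)) _.
by rewrite mulrBr; lra.
Qed.

Lemma geometric_sum_le (R : realFieldType) (q : R) (n : nat) :
  0 < q <= 1 -> \sum_(k < n) (1 - q) ^+ k <= q^-1.
Proof.
move=> /andP[q0 q1]; rewrite -[leRHS]mul1r ler_pdivlMr//.
have := subrX1 (1 - q) n; rewrite addrAC subrr add0r mulNr => E.
rewrite mulrC -[leLHS]opprK -E opprB lerBlDr lerDl.
by rewrite exprn_ge0// subr_ge0.
Qed.

(** The integral is a supremum over the simple functions below the integrand, so it is monotone on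
    arbitrary nonnegative functions. It is applied to the cost itself, whose measurability is not
    examined. *)
Lemma ge0_le_integralT {dT : measure_display} {T : measurableType dT}
    {R : realType} (mu : {measure set T -> \bar R}) (f g : T -> \bar R) :
    (forall x, 0 <= f x)%E -> (forall x, f x <= g x)%E ->
  (\int[mu]_x f x <= \int[mu]_x g x)%E.
Proof.
move=> f0 fg; have g0 x : (0 <= g x)%E by exact: le_trans (f0 x) (fg x).
rewrite !ge0_integralTE//; apply: ereal_sup_le => _ [h hf <-].
by exists h => // x; exact: le_trans (hf x) (fg x).
Qed.

(** * From the independent scalars to i.i.d. vectors *)

Section SigmaOf.
Context {dT dU : measure_display} {T : measurableType dT} {U : measurableType dU}.
Variable X : T -> U.

Lemma sigma_ofT : sigma_of X setT.
Proof. by exists setT => //; rewrite setTI preimage_setT. Qed.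

Lemma sigma_ofI : setI_closed (sigma_of X).
Proof.
move=> _ _ [A mA <-] [B mB <-]; exists (A `&` B); first exact: measurableI.
by rewrite preimage_setI setIACA setIid.
Qed.

Lemma sigma_of_preimage A : measurable A -> sigma_of X (X @^-1` A).
Proof. by move=> mA; exists A => //; rewrite setTI. Qed.

Lemma sigma_of_measurable : measurable_fun setT X -> sigma_of X `<=` measurable.
Proof. by move=> mX _ [A mA <-]; exact: mX. Qed.

End SigmaOf.

Lemma iid_sample_of_independent {dT : measure_display} {T : measurableType dT}
    {R : realType} (P : probability T R) (D : probability R R) (I : choiceType)
    (F : I -> set (set T)) (d : nat) (X : 'I_d -> {RV P >-> R}) (idx : 'I_d -> I) :
    independent_events P F -> (forall x, F x setT) -> injective idx ->
    (forall i, sigma_of (X i) `<=` F (idx i)) -> (forall i, has_law (X i) D) ->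
  iid_sample D X.
Proof.
move=> iF FT idx_inj XF XD A mA.
(* Indices outside the image of [idx] receive the whole space, so that they do not constrain the
   event. *)
pose E x := if [pick i | idx i == x] is Some i then X i @^-1` A i else setT.
have Eidx i : E (idx i) = X i @^-1` A i.
  rewrite /E; case: pickP => [j /eqP/idx_inj -> //|/(_ i)]; by rewrite eqxx.
have FE x : F x (E x).
  rewrite /E; case: pickP => [i /eqP <-|_]; last exact: FT.
  by apply: XF; exact: sigma_of_preimage.
have := independent_seq (s := map idx (index_enum 'I_d)) iF _ FE.
rewrite map_inj_uniq// index_enum_uniq => /(_ isT).
rewrite !big_map => h.
under eq_bigr do rewrite -Eidx; rewrite h; apply: eq_bigr => i _.
by rewrite Eidx -(XD i _ (mA i)).
Qed.

(** * Expected cost of a round *)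

Section Round.
Context {dT : measure_display} {T : measurableType dT} {R : realType}.
Context (P : probability T R) (D : probability R R) (d m : nat).
Context (eta : R) (L : 'I_d -> R) (sigma : 'I_d -> nat).
Context (r : 'I_d -> {RV P >-> R}) (r' : nat -> 'I_d -> {RV P >-> R}).
Context (theta : nat -> {RV P >-> nat}).
Hypotheses (m_gt0 : (1 <= m)%N) (md : (m <= d)%N) (eta0 : 0 < eta).
Hypotheses (sigmaP : is_ranking L sigma) (cD : continuous_distribution D).
Hypothesis rnd : cgr_randomness D m r r' theta.

Let F (x : 'I_d + nat * option 'I_d) : set (set T) :=
  match x with
  | inl i => sigma_of (r i)
  | inr (k, Some i) => sigma_of (r' k i)
  | inr (k, None) => sigma_of (theta k)
  end.

Let iF : independent_events P F. Proof. by case: rnd. Qed.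

Let FT x : F x setT.
Proof. by case: x => [i|[k [i|]]]; exact: sigma_ofT. Qed.

Let FI x : setI_closed (F x).
Proof. by case: x => [i|[k [i|]]]; exact: sigma_ofI. Qed.

Let Fm x : F x `<=` measurable.
Proof.
by case: x => [i|[k [i|]]]; apply: sigma_of_measurable; exact: measurable_funPT.
Qed.

Let samples x k : ('I_d -> R) * nat := ((fun i => r' k i x), theta k x).
Let a x := ftpl_action m eta L r x.

Lemma vec_joint_events (Y : 'I_d -> {RV P >-> R}) idx s (B : set (d.-tuple R)) :
    uniq s -> (forall i, idx i \in s) ->
    (forall i, sigma_of (Y i) `<=` F (idx i)) -> measurable B ->
  <<s joint_events F s >> (vec Y @^-1` B).
Proof.
move=> us is_ YF mB; apply: sub_generated_sigma_of_vec => // i A /YF FA.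
by apply: sub_sigma_algebra; exact: joint_events_sub us (is_ i) FA.
Qed.

Lemma iid_r : iid_sample D r.
Proof.
have [rD _ _ _] := rnd.
apply: (iid_sample_of_independent (idx := inl) iF FT) => //.
  by move=> i j [].
by move=> i A.
Qed.

Lemma iid_r' k : iid_sample D (r' k).
Proof.
have [_ r'D _ _] := rnd.
apply: (iid_sample_of_independent (idx := fun i => inr (k, Some i)) iF FT) => //.
  by move=> i j [].
by move=> i A.
Qed.

Lemma theta_r'_independent k t (B : set (d.-tuple R)) : measurable B ->
  P (theta k @^-1` [set t] `&` vec (r' k) @^-1` B) =
  (P (theta k @^-1` [set t]) * P (vec (r' k) @^-1` B))%E.
Proof.
move=> mB.
(* Block 0 holds [theta k] and block 1 the coordinates of [r' k]; the further blocks are empty. *)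
pose l n : seq ('I_d + nat * option 'I_d) := match n with
  | 0%N => [:: inr (k, None)]
  | 1%N => [seq inr (k, Some i) | i <- enum 'I_d]
  | _ => [::] end.
pose b (x : 'I_d + nat * option 'I_d) :=
  match x with inr (_, None) => 0%N | _ => 1%N end.
pose E n := match n with
  | 0%N => theta k @^-1` [set t]
  | 1%N => vec (r' k) @^-1` B
  | _ => setT end.
have := @independent_blocks _ _ _ P _ F FT FI Fm l b 2 E iF.
rewrite !big_ord_recl !big_ord0 /= setIT mule1; apply.
- move=> [|[|n]] //=; rewrite map_inj_uniq ?enum_uniq//.
  by move=> i j [].
- by move=> [|[|n]] //= x; [rewrite inE => /eqP ->|case/mapP => i _ ->].
- move=> [|[|n]] /=.
  + apply: sub_sigma_algebra; apply: (joint_events_sub FT (x := inr (k, None))) => //.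
      by rewrite inE eqxx.
    exact: sigma_of_preimage.
  + apply: (@vec_joint_events _ (fun i => inr (k, Some i))) => //.
    * by rewrite map_inj_uniq ?enum_uniq// => i j [].
    * by move=> i; apply: map_f; rewrite mem_enum.
    * by move=> i A.
  + by apply: sub_sigma_algebra; exact: joint_eventsT.
Qed.

Let w i := fine (P [set x | a x i]).

Let wE i : P [set x | a x i] = (w i)%:E.
Proof.
rewrite /w fineK// fin_num_measure//; apply: measurable_best_action => k.
exact: measurable_funPT.
Qed.

(** For ranks above [m] this is only a lower bound of the hit probability, which suffices for an
    upper bound on waiting. *)
Let q i : R := if (m < sigma i)%N then (sigma i)%:R / m%:R * w i else w i.

Let hit k i := [set x | swap_success m eta L sigma (samples x k) i].

Let vecE (Y : 'I_d -> {RV P >-> R}) x : tnth (vec Y x) = fun i => Y i x.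
Proof. by apply/funext => j; rewrite tnth_mktuple. Qed.

(** Splitting over the value of [theta k] turns the event into a union of rectangles, in which index
    and perturbation are separated. *)
Let hitE k i : hit k i =
  if (m < sigma i)%N then
    \bigcup_t (theta k @^-1` [set t] `&` vec (r' k) @^-1`
      [set v | best_action m eta L (tnth v \o tperm i
        (kth_largest (tnth v) [set j | (sigma j <= sigma i)%N]%SET t i)) i])
  else vec (r' k) @^-1` [set v | best_action m eta L (tnth v) i].
Proof.
rewrite /hit /swap_success; case: ifP => _; apply/seteqP; split => x /=.
- by move=> h; exists (theta k x) => //; split => //=; rewrite vecE.
- by move=> [t _ [/= <-]]; rewrite vecE.
- by rewrite vecE.
- by rewrite vecE.
Qed.

Let msw i t : measurable [set v : d.-tuple R | best_action m eta L (tnth v \o tperm i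
        (kth_largest (tnth v) [set j | (sigma j <= sigma i)%N]%SET t i)) i].
Proof.
apply: (@measurable_swapped_best_action _ _ _ _ _ (fun v : d.-tuple R => tnth v)).
by move=> k; exact: measurable_tnth.
Qed.

Let mba i : measurable [set v : d.-tuple R | best_action m eta L (tnth v) i].
Proof. by apply: measurable_best_action => k; exact: measurable_tnth. Qed.

(** Block 0 carries the FTPL perturbation and block [k.+1] the randomness of iteration [k], so that
    [event i n] depends on block [n] only. *)
Let block n : seq ('I_d + nat * option 'I_d) :=
  if n is k.+1 then [seq inr (k, o) | o <- index_enum (option 'I_d)]
  else [seq inl i | i <- index_enum 'I_d].

Let block_uniq n : uniq (block n).
Proof.
by case: n => [|k]; rewrite map_inj_uniq ?index_enum_uniq// => i j [].
Qed.

Let event i n := if n is k.+1 then ~` hit k i else [set x | a x i].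

Let sigma_event i n : <<s joint_events F (block n) >> (event i n).
Proof.
case: n => [|k] /=.
  rewrite (_ : [set x | a x i] =
      vec r @^-1` [set v | best_action m eta L (tnth v) i]).
    apply: (@vec_joint_events _ inl) => //; first exact: block_uniq 0.
      by move=> j; apply: map_f; rewrite mem_index_enum.
    by move=> j A.
  by apply/seteqP; split => x /=; rewrite vecE.
have vk B : measurable B -> <<s joint_events F (block k.+1) >> (vec (r' k) @^-1` B).
  apply: (@vec_joint_events _ (fun j => inr (k, Some j))).
  - exact: block_uniq k.+1.
  - by move=> j; apply: map_f; rewrite mem_index_enum.
  - by move=> j A.
suff : @measurable _ (g_sigma_algebraType (joint_events F (block k.+1))) (~` hit k i).
  by [].
apply: measurableC; rewrite hitE; case: ifP => _; last exact: vk.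
apply: bigcup_measurable => t _; apply: measurableI; last exact: vk.
apply: sub_sigma_algebra; apply: (joint_events_sub FT (x := inr (k, None))).
- exact: block_uniq k.+1.
- by apply: map_f; rewrite mem_index_enum.
- exact: sigma_of_preimage.
Qed.

Let event_measurable i n : measurable (event i n).
Proof.
have := @sigma_event i n; apply: smallest_sub; first exact: sigma_algebra_measurable.
by apply: joint_events_measurable => x; exact: Fm.
Qed.

Let P_hit k i : ((q i)%:E <= P (hit k i))%E.
Proof.
rewrite hitE /q; case: ifP => ms.
  set V := fun t => [set v : d.-tuple R | best_action m eta L (tnth v \o tperm i
    (kth_largest (tnth v) [set j | (sigma j <= sigma i)%N]%SET t i)) i].
  pose H t := theta k @^-1` [set t] `&` vec (r' k) @^-1` V t.
  have mvV t : measurable (vec (r' k) @^-1` V t).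
    by rewrite -[X in measurable X]setTI; apply: measurable_vec => //; exact: msw.
  have mH t : measurable (H t).
    by apply: measurableI => //; rewrite -[X in measurable X]setTI; exact: measurable_funPT.
  (* The values [1..m] of [theta] are retained, each of probability [1 / m]. *)
  have : (\sum_(t < m) P (H t.+1) <= P (\bigcup_t H t))%E.
    rewrite -(@measure_bigsetU_ord _ _ _ P m xpredT (fun t => H t.+1))//.
      apply: le_measure; rewrite ?inE.
      - by apply: bigsetU_measurable => t _; exact: mH.
      - by apply: bigcup_measurable => t _; exact: mH.
      - by rewrite -(bigcup_mkord m (fun t => H t.+1)) => x [t _ Ht]; exists t.+1.
    by move=> s t _ _ [x [[/= sE _] [/= tE _]]]; apply/val_inj/succn_inj; rewrite -sE -tE.
  apply: le_trans.
  have := swapped_prob m_gt0 md eta0 sigmaP cD (iid_r' k) i.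
  (* A fresh sample has the law of [r], hence plays [i] with probability [w i]. *)
  have -> : P [set x | best_action m eta L (fun j => r' k j x) i] = (w i)%:E.
    have -> : [set x | best_action m eta L (fun j => r' k j x) i] =
        vec (r' k) @^-1` [set v | best_action m eta L (tnth v) i].
      by apply/seteqP; split => x /=; rewrite vecE.
    rewrite (iid_sample_law (iid_r' k) iid_r (mba i)) -wE; congr (P _).
    by apply/seteqP; split => x /=; rewrite vecE.
  rewrite -EFinM => /(lee_wpmul2l (x := (m%:R^-1)%:E)).
  rewrite lee_fin invr_ge0 ler0n -EFinM => /(_ isT).
  rewrite mulrA [m%:R^-1 * _]mulrC => /le_trans; apply.
  rewrite ge0_sume_distrr; last by move=> t _; exact: measure_ge0.
  apply: lee_sum => t _; rewrite theta_r'_independent; last exact: msw.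
  have [_ _ -> _] := rnd; rewrite ltn_ord /= le_eqVlt; apply/orP; left; apply/eqP.
  by congr (_ * P _)%E; apply/seteqP; split => x /=; rewrite /V /= vecE.
rewrite (iid_sample_law (iid_r' k) iid_r (mba i)) -wE le_eqVlt.
apply/orP; left; apply/eqP; congr (P _).
by apply/seteqP; split => x /=; rewrite vecE.
Qed.

Let wait k i := [set x | waiting m eta L sigma (samples x) (a x) k i].

Let waitE k i : wait k i = \big[setI/setT]_(j < k.+1) event i j.
Proof.
rewrite big_ord_recl /wait /waiting; apply/seteqP; split => x /=.
  move=> /andP[ax /forallP h]; split => //.
  rewrite -(bigcap_mkord k (fun j => event i j.+1)) => j /= jk.
  by have /negP := h (Ordinal jk).
move=> [ax]; rewrite -(bigcap_mkord k (fun j => event i j.+1)) => h.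
by rewrite [a x i]ax; apply/forallP => j; apply/negP; exact: (h j (ltn_ord j)).
Qed.

(** The event of being played and the [k] misses lie in different blocks, and each miss has
    probability at most [1 - q i]. *)
Let P_wait k i : (P (wait k i) <= (w i * (1 - q i) ^+ k)%:E)%E.
Proof.
pose b (x : 'I_d + nat * option 'I_d) := if x is inr (k, _) then k.+1 else 0%N.
have blockb n x : x \in block n -> b x = n.
  by case: n => [|n] /mapP[y _ ->].
rewrite waitE (independent_blocks FT FI Fm k.+1 iF block_uniq blockb (@sigma_event i)).
have w0 : 0 <= w i by rewrite fine_ge0.
rewrite big_ord_recl /= wE EFinM lee_wpmul2l ?lee_fin//.
elim: k => [|k IH]; first by rewrite big_ord0.
rewrite big_ord_recr exprSr EFinM lee_pmul//=.
  by apply: prode_ge0 => j _; exact: measure_ge0.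
have mh : measurable (hit k i).
  by rewrite -[X in measurable X]setCK; apply: measurableC; exact: event_measurable i k.+1.
by rewrite probability_setC// EFinB leeB// P_hit.
Qed.

(** The geometric series gives [w i / q i], where [w i] cancels; its positivity makes [q i]
    invertible. *)
Let sum_P_wait n i : (0 < P [set x | a x i])%E ->
  (\sum_(k < n) P (wait k i) <=
    (if (m < sigma i)%N then m%:R / (sigma i)%:R else 1)%:E)%E.
Proof.
move=> w0; have := w0; rewrite wE lte_fin => wi0.
have q1 : q i <= 1.
  rewrite -lee_fin; apply: le_trans (P_hit 0 i) _; apply: probability_le1.
  rewrite -[X in measurable X]setCK; apply: measurableC.
  exact: event_measurable i 1.
have s0 : (m < sigma i)%N -> 0 < (sigma i)%:R :> R.
  by move=> ms; rewrite ltr0n (leq_ltn_trans _ ms).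
have m0 : 0 < m%:R :> R by rewrite ltr0n.
have q0 : 0 < q i.
  by rewrite /q; case: ifP => [/s0 s_gt0|//]; rewrite mulr_gt0// divr_gt0.
apply: (@le_trans _ _ (\sum_(k < n) (w i * (1 - q i) ^+ k)%:E)%E).
  by apply: lee_sum => k _; exact: P_wait.
rewrite sumEFin lee_fin -mulr_sumr.
have := geometric_sum_le n; move=> /(_ _ (q i)); rewrite q0 q1 => /(_ isT).
move=> /(ler_wpM2l (ltW wi0)) /le_trans; apply.
rewrite /q; case: ifP => [/s0 s_gt0|_]; last by rewrite divff ?gt_eqF.
by rewrite le_eqVlt; apply/orP; left; apply/eqP; field; rewrite !gt_eqF.
Qed.

(** The truncated costs are dominated by a nondecreasing sequence [g], so monotone convergence
    reduces the claim to a bound on each integral. The first [m] pays for initialization and output,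
    the second for the first [m] ranks. *)
Lemma expected_cgr_cost_le (c : nat) (cm : cost_model) : cost_model_le c cm ->
    (forall i, 0 < ftpl_prob m eta L r i)%E ->
  (expected_cgr_cost cm m eta L sigma r r' theta <=
    ((c * (22 * d))%:R *
      (m%:R + (m%:R + m%:R * ln (d%:R / m%:R))))%:E)%E.
Proof.
move=> cmc w0; have d0 : (0 < d)%N by exact: leq_trans md.
set C : R := (c * (22 * d))%:R.
have C0 : 0 <= C by exact: ler0n.
pose W n x : R := m%:R + \sum_(k < n) \sum_(i < d) \1_(wait k i) x.
pose g n x := (C * W n x)%:E.
have mwait k i : measurable (wait k i).
  by rewrite waitE; apply: bigsetI_measurable => j _; exact: event_measurable.
have W_nd n n' x : (n <= n')%N -> W n x <= W n' x.
  move=> nn'; rewrite lerD2l -!(big_mkord xpredT (fun k => \sum_(i < d) \1_(wait k i) x)).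
  rewrite [leRHS](big_cat_nat _ nn')//= lerDl; apply: sumr_ge0 => k _.
  by apply: sumr_ge0 => i _; rewrite indicE.
have W0 n x : 0 <= W n x.
  by rewrite addr_ge0//; apply: sumr_ge0 => k _; apply: sumr_ge0 => i _; rewrite indicE.
have mW n : measurable_fun setT (W n).
  apply: measurable_funD => //; apply: measurable_sum => k; apply: measurable_sum => i.
  exact: measurable_indic.
have g0 n x : (0 <= g n x)%E by rewrite lee_fin mulr_ge0.
have mg n : measurable_fun setT (g n).
  by apply/measurable_EFinP; apply: measurable_funM.
have g_nd x : nondecreasing_seq (g ^~ x).
  by move=> n n' nn'; rewrite lee_fin ler_wpM2l// W_nd.
have cost_g x : (cgr_cost cm m eta L sigma (samples x) (a x) <= limn (g ^~ x))%E.
  apply: ge_ereal_sup => _ [n _ <-].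
  have /cvg_lim -> // := ereal_nondecreasing_cvgn (g_nd x).
  apply: le_ereal_sup_tmp; exists (g n x); first by exists n.
  have := cgr_cost_le eta L sigma cmc d0 (samples x) n m_gt0
    (best_actionP eta L md (fun i => r i x)).
  rewrite -(ler_nat R) natrM natrD natr_sum lee_fin => /le_trans; apply.
  rewrite ler_wpM2l// lerD2l; apply: ler_sum => k _; rewrite natr_sum.
  apply: ler_sum => i _; rewrite indicE; case: (boolP (waiting _ _ _ _ _ _ _ _)) => //.
  by move=> wx; rewrite mem_set.
have int_g n : (\int[P]_x g n x <= (C * (m%:R + (m%:R + m%:R * ln (d%:R / m%:R))))%:E)%E.
  under eq_integral do rewrite /g EFinM.
  rewrite ge0_integralZl_EFin//; last 2 first.
    by move=> x _; rewrite lee_fin.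
    exact/measurable_EFinP.
  rewrite EFinM lee_wpmul2l ?lee_fin//.
  under eq_integral do rewrite /W EFinD -sumEFin.
  rewrite ge0_integralD//; last 2 first.
    by move=> x _; apply: sume_ge0 => k _; rewrite lee_fin; apply: sumr_ge0 => i _;
      rewrite indicE.
    apply: emeasurable_sum => k; apply/measurable_EFinP; apply: measurable_sum => i.
    exact: measurable_indic.
  rewrite integral_cst// [X in (_ * X)%E]probability_setT mule1 EFinD leeD2l//.
  rewrite ge0_integral_sum//; last 2 first.
    move=> k; apply/measurable_EFinP; apply: measurable_sum => i.
    exact: measurable_indic.
    by move=> k x _; rewrite lee_fin; apply: sumr_ge0 => i _; rewrite indicE.
  have -> : (\sum_(k < n) \int[P]_x (\sum_(i < d) \1_(wait k i) x)%:E)%E =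
      (\sum_(k < n) \sum_(i < d) P (wait k i))%E.
    apply: eq_bigr => k _; under eq_integral do rewrite -sumEFin.
    rewrite ge0_integral_sum//.
      by apply: eq_bigr => i _; rewrite integral_indic// setIT.
    by move=> i; apply/measurable_EFinP; exact: measurable_indic.
  (* Summing over the iterations first leaves one geometric series for each arm. *)
  rewrite exchange_big/=.
  apply: (@le_trans _ _ (\sum_(i < d)
      (if (m < sigma i)%N then m%:R / (sigma i)%:R else 1)%:E)%E).
    by apply: lee_sum => i _; exact: sum_P_wait (w0 i).
  rewrite sumEFin lee_fin.
  rewrite (sum_ranking (fun k => if (m < k)%N then m%:R / k%:R else 1) sigmaP).
  exact: truncated_harmonic_le.
apply: (@le_trans _ _ (\int[P]_x limn (g ^~ x))%E).
  (* The cost is nonnegative because it dominates that of the run truncated at 0 iterations. *)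
  apply: ge0_le_integralT => // x; apply: le_ereal_sup_tmp.
  exists ((cgr cm m eta L sigma (samples x) (a x) 0).2%:R)%:E; last by rewrite lee_fin.
  by exists 0%N.
apply: cvge_le (cvg_monotone_convergence measurableT mg _ _).
- by near=> n; exact: int_g.
- by move=> n x _; exact: g0.
- by move=> x _; exact: g_nd.
Unshelve. all: by end_near. Qed.

End Round.

Local Close Scope classical_set_scope.

Theorem mainTheorem4 (c : nat) :
  exists K : nat,
  forall (cm : cost_model), cost_model_le c cm ->
  forall (R : realType) (D : probability R R), continuous_distribution D ->
  forall (d m : nat), (1 <= m)%N -> (m <= d)%N ->
  forall (L : 'I_d -> R) (eta : R), (forall i, 0 <= L i) -> 0 < eta ->
  forall (sigma : 'I_d -> nat), is_ranking L sigma ->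
  forall (dT : measure_display) (T : measurableType dT) (P : probability T R)
    (r : 'I_d -> {RV P >-> R}) (r' : nat -> 'I_d -> {RV P >-> R})
    (theta : nat -> {RV P >-> nat}),
    cgr_randomness D m r r' theta ->
    (forall i, (0 < ftpl_prob m eta L r i)%E) ->
    (expected_cgr_cost cm m eta L sigma r r' theta
       <= (K%:R * (m%:R * d%:R * (ln (d%:R / m%:R) + 1)))%:E)%E.
Proof.
(* The bound [22 * c * d * (2 * m + m * l)] is at most [44 * c * m * d * (l + 1)], since
   [l >= 0]. *)
exists (44 * c)%N => cm cmc R D cD d m m1 md L eta _ eta0 sigma sigmaP dT T P.
move=> r r' theta rnd w0.
apply: le_trans (expected_cgr_cost_le m1 md eta0 sigmaP cD rnd cmc w0) _.
rewrite lee_fin !natrM; set l := ln _.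
have l0 : 0 <= l.
  by rewrite ln_ge0// ler_pdivlMr ?mul1r ?ler_nat// ltr0n.
have : 0 <= c%:R * (m%:R * d%:R * l) :> R by rewrite !mulr_ge0.
by nra.
Qed.
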